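(* Let $\alpha\in\mathbb{R}$ be a quadratic irrational, and let $\varepsilon>0$ be given. Then there is a constant $C(\alpha,\varepsilon)$ such that, for every positive integer $N$, there exist $a\in\mathbb{Z}$ and a positive integer $q\le N$ with \[\left|\alpha-\frac{a}{q}\right|\le\frac{C(\alpha,\varepsilon)}{qN}\] and such that $q$ has no prime factor $p>q^{\varepsilon}$.
   Context: A quadratic irrational is an irrational real number that is a root of a quadratic polynomial with integer coefficients. *)

(* Defs.v *)
From mathcomp Require Import all_boot all_order all_algebra.
From mathcomp Require Import all_classical all_reals exp.

Set Implicit Arguments.
Unset Strict Implicit.
Unset Printing Implicit Defensive.

Import Order.TTheory GRing.Theory Num.Theory.

Local Open Scope ring_scope.

(* [size p = 3] says that [p] has degree exactly two. *)
Definition quadratic_irrational (R : realType) (alpha : R) : Prop :=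
  irrational alpha /\
  exists p : {poly int}, size p = 3 /\ root (map_poly intr p) alpha.

(* Main.v *)
Require Import Defs.
From mathcomp Require Import all_boot all_order all_algebra.
From mathcomp Require Import all_classical all_reals exp.
From mathcomp Require Import sequences algC cyclotomic.
From mathcomp Require Import zify ring lra.

(** Take a nonzero integer [m] and an integer [b] such that [s = m alpha + b] is
    positive with [s ^ 2 = D] a natural number.  The Pell equation
    [x ^ 2 = D y ^ 2 + 1] has a solution [(x1, y1)] with [y1 > 0]
    ([pell_exists]); let [e = x1 + y1 s > 1], so that [e ^ n = x_n + y_n s] gives
    further solutions, and put [q = |m| y_n].  Since
    [(x_n - y_n s) (x_n + y_n s) = 1], the number [q alpha] is within [1 / y_n]
    of an integer ([pell_approx]), which is of the required order whenever [N]
    is at most a constant multiple of [q].  As [y_n] grows geometrically, the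
    [n] may be restricted to the multiples of any fixed number and some [q <= N]
    with this property will still exist for every large [N]
    ([geometric_bracket]); for the bounded values of [N] that remain, [q = 1]
    will do.

    That freedom in [n] is what makes [q] smooth.  With [e' = e ^ -1] the
    conjugate of [e],
      [- 4 D y_n ^ 2 = (e ^ (2 n) - 1) (e' ^ (2 n) - 1)],
    and factoring ['X^(2 n) - 1] into cyclotomic polynomials writes the right
    side as the product over [d %| 2 n] of the integers ['Phi_d(e) 'Phi_d(e')].
    A prime divisor of [y_n] divides one of these.  The roots of ['Phi_d] have
    modulus 1, so this factor is at most
    [((1 + e) (1 + e')) ^ totient d <= (2 x1 + 2) ^ totient (2 n)]
    ([prime_dvd_pell_pow_le]).  On the other hand [q >= 2 ^ (n - 1)].  It
    remains to make [totient (2 n)] a small multiple of [n], and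
    [totient m / m] is as small as desired on all multiples of a suitable [M],
    because the harmonic series diverges ([totient_small]). *)

Set Implicit Arguments.
Unset Strict Implicit.
Unset Printing Implicit Defensive.

Import Order.TTheory GRing.Theory Num.Theory.

Local Open Scope ring_scope.

(** * Small values of the totient ratio *)

Lemma totient_mul_prime_ge p d : prime p -> (totient d <= totient (p * d))%N.
Proof.
move=> p_pr; have [->|d_gt0] := posnP d; first by rewrite muln0.
have [c co_pc ->] := pfactor_coprime p_pr d_gt0.
move: (logn p d) => e; rewrite mulnCA -expnS.
rewrite !totient_coprime ?coprimeXr 1?coprime_sym //.
rewrite leq_mul2l; apply/orP; right.
case: e => [|e]; first by rewrite expn0 totient_gt0 expn_gt0 prime_gt0.
by rewrite !totient_pfactor //= leq_mul2l leq_pexp2l ?orbT // prime_gt0.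
Qed.

(** Pass from [d] to [m] by one prime factor at a time. *)
Lemma dvdn_totient_leq d m : (0 < m)%N -> (d %| m)%N ->
  (totient d <= totient m)%N.
Proof.
move=> m_gt0 /dvdnP[k def_m]; move: m_gt0; rewrite {}def_m.
elim/ltn_ind: k => k IHk; rewrite muln_gt0 => /andP[k_gt0 d_gt0].
have [k1|k_gt1|->] := ltngtP k 1; [lia| |by rewrite mul1n].
have p_pr := pdiv_prime k_gt1.
rewrite -(divnK (pdiv_dvd k)) mulnAC -(mulnC (pdiv k)).
apply: leq_trans (totient_mul_prime_ge _ p_pr).
have k'_gt0 : (0 < k %/ pdiv k)%N.
  by rewrite divn_gt0 ?pdiv_gt0 // dvdn_leq // pdiv_dvd.
apply: IHk; first by rewrite ltn_Pdiv // prime_gt1.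
by rewrite muln_gt0 k'_gt0.
Qed.

Lemma eq_of_mul_coprime m k k' c c' : (k %| m)%N -> (k' %| m)%N ->
  coprime m c -> coprime m c' -> (k * c = k' * c')%N -> k = k'.
Proof.
move=> k_m k'_m co_c co_c' e; apply/eqP; rewrite eqn_dvd; apply/andP; split.
  by rewrite -(Gauss_dvdl _ (coprime_dvdl k_m co_c')) -e dvdn_mulr.
by rewrite -(Gauss_dvdl _ (coprime_dvdl k'_m co_c)) e dvdn_mulr.
Qed.

(** The products [k * c] with [k <= r], [c] coprime to [m] and [k * c < m * m]
    are pairwise distinct by [eq_of_mul_coprime], and for given [k] the bound
    [c < m * (m / k)] leaves [totient m] values of [c] in each of [m / k] periods
    of length [m]. *)
Lemma sum_totient_div_leq m r : (0 < m)%N ->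
    (forall k, (k < r)%N -> (k.+1 %| m)%N) ->
  (\sum_(k < r) totient m * (m %/ k.+1) <= m * m)%N.
Proof.
move=> m_gt0 dvd_m.
have mm : (m * m).-1.+1 = (m * m)%N by rewrite prednK ?muln_gt0 ?m_gt0.
pose C := [set c : 'I_m | coprime m c].
have cardC : #|C| = totient m.
  rewrite totient_count_coprime big_mkord -sum1_card big_mkcond /=.
  by apply: eq_bigr => i _; rewrite inE; case: coprime.
(* The product [k.+1 * c], where [u] is the remainder and quotient of [c] by
   [m]. *)
pose v k (u : 'I_m * 'I_(m %/ k.+1)) := (k.+1 * (u.2 * m + u.1))%N.
pose F (k : 'I_r) : {set 'I_(m * m).-1.+1} :=
  [set inord (v k u) | u in finset.setX C finset.setT].
have v_lt (k : 'I_r) u : (v k u < (m * m).-1.+1)%N.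
  rewrite mm /v -[X in (_ < X * _)%N](divnK (dvd_m k (ltn_ord k))).
  rewrite mulnAC [X in (_ < X)%N]mulnC ltn_pmul2l //.
  apply: leq_trans (_ : u.2.+1 * m <= _)%N.
    by rewrite mulSn addnC ltn_add2r.
  by rewrite leq_mul2r ltn_ord orbT.
have card_F k : #|F k| = (totient m * (m %/ k.+1))%N.
  rewrite card_in_imset ?cardsX ?cardC ?cardsT ?card_ord //.
  move=> [c j] [c' j'] _ _ /(congr1 (@nat_of_ord _)).
  rewrite !inordK // /v /= => /eqP.
  rewrite eqn_mul2l /= => /eqP e; congr (_, _); apply: val_inj => /=.
    have := congr1 (modn^~ m) e.
    by rewrite !(modnMDl, modn_small).
  have := congr1 (divn^~ m) e.
  by rewrite !divnMDl // (divn_small (ltn_ord c)) (divn_small (ltn_ord c')) !addn0.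
have disjF i j : i != j -> [disjoint F i & F j].
  move=> neq_ij; rewrite -setI_eq0; apply/eqP/setP => x; rewrite !inE.
  apply: contraNF neq_ij => /andP[/imsetP[[c1 u1] C1 ->] /imsetP[[c2 u2] C2]].
  move/(congr1 (@nat_of_ord _)); rewrite !inordK // /v /= => e.
  move: C1 C2; rewrite !inE !andbT /= => C1 C2.
  have co c q : coprime m c -> coprime m (q * m + c).
    by rewrite /coprime gcdnMDl.
  apply/eqP/val_inj/succn_inj.
  exact: (eq_of_mul_coprime (dvd_m i _) (dvd_m j _) (co _ _ C1) (co _ _ C2) e).
under eq_bigr do rewrite -card_F -sum1_card.
rewrite -(partition_disjoint_bigcup _ _ disjF) sum1_card.
apply: leq_trans (max_card _) _.
by rewrite card_ord mm.
Qed.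

Lemma series_harmonic_unbounded (R : realType) (T : R) :
  exists r : nat, T <= series harmonic r.
Proof.
apply: contra_notP (@dvg_harmonic R) => noT.
apply: nondecreasing_is_cvgn.
  apply/nondecreasing_seqP => n; rewrite seriesSr lerDl.
  exact: harmonic_ge0.
exists T => _ [n _ <-]; rewrite leNgt; apply/negP => /ltW lt_T.
by apply: noT; exists n.
Qed.

(** Dividing [sum_totient_div_leq] by [m]; this is the part of the inequality
    [totient m * sigma m <= m ^ 2] that comes from the divisors up to [r]. *)
Lemma totient_harmonic_leq (R : realType) m r : (0 < m)%N ->
    (forall k, (k < r)%N -> (k.+1 %| m)%N) ->
  (totient m)%:R * series harmonic r <= m%:R :> R.
Proof.
move=> m_gt0 dvd_m; have m_gt0R : 0 < m%:R :> R by rewrite ltr0n.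
rewrite -(ler_pM2l m_gt0R) -[leRHS]natrM.
have := sum_totient_div_leq m_gt0 dvd_m.
rewrite -(ler_nat R); apply: le_trans; rewrite le_eqVlt; apply/orP; left.
rewrite natr_sum /series /= big_mkord mulr_sumr mulr_sumr; apply/eqP/eq_bigr => k _.
have kR : k.+1%:R != 0 :> R by rewrite pnatr_eq0.
have def_m : m%:R = (m %/ k.+1)%:R * k.+1%:R :> R.
  by rewrite -natrM divnK ?dvd_m.
by rewrite natrM def_m /harmonic /= mulrACA divff // mulr1 mulrC.
Qed.

Lemma totient_small (R : realType) (delta : R) : 0 < delta ->
  exists2 M : nat, (0 < M)%N &
    forall m, (0 < m)%N -> (M %| m)%N -> (totient m)%:R <= delta * m%:R :> R.
Proof.
move=> d_gt0; have [r le_r] := @series_harmonic_unbounded R delta^-1.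
exists r`!; first exact: fact_gt0.
move=> m m_gt0 M_m; rewrite mulrC -ler_pdivrMr //.
apply: le_trans (totient_harmonic_leq R m_gt0 (r := r) _).
  by rewrite ler_wpM2l.
by move=> k lt_kr; apply: dvdn_trans M_m; rewrite dvdn_fact.
Qed.

(** * The Pell equation *)

(** Pigeonhole: two of the [Q + 1] fractional parts of [i * s], [i <= Q], share
    one of the [Q] subintervals of length [1 / Q]. *)
Lemma dirichlet_approx (R : realType) (s : R) (Q : nat) : (0 < Q)%N ->
  exists (x : int) (y : nat),
    [/\ (0 < y)%N, (y <= Q)%N & `|x%:~R - y%:R * s| < Q%:R^-1].
Proof.
case: Q => // Q _.
pose frac (i : nat) : R := i%:R * s - (Num.floor (i%:R * s))%:~R.
have frac01 i : 0 <= frac i < 1.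
  have /andP[le_fl lt_fl] := floor_itv (i%:R * s).
  by rewrite subr_ge0 le_fl ltrBlDl -[ltRHS]intrD1.
have QR : 0 < Q.+1%:R :> R by rewrite ltr0n.
have Qfrac_ge0 i : 0 <= Q.+1%:R * frac i.
  by rewrite mulr_ge0 ?ler0n //; case/andP: (frac01 i).
pose bin (i : 'I_Q.+2) : 'I_Q.+1 := inord (Num.truncn (Q.+1%:R * frac i)).
have [i [j lt_ij same_bin]] : exists i : 'I_Q.+2, exists2 j : 'I_Q.+2,
    (i < j)%N & bin i = bin j.
  have /injectivePn[i [j neq_ij e]] : ~~ injectiveb bin.
    by apply/injectiveP => /leq_card; rewrite !card_ord ltnn.
  case: (ltngtP i j) => [lt_ij|lt_ji|/val_inj eq_ij].
  - by exists i, j.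
  - by exists j, i.
  - by rewrite eq_ij eqxx in neq_ij.
exists (Num.floor (j%:R * s) - Num.floor (i%:R * s)), (j - i)%N; split.
- by rewrite subn_gt0.
- by rewrite (leq_trans (leq_subr _ _)) // -ltnS.
have trunc_lt k : (Num.truncn (Q.+1%:R * frac k) < Q.+1)%N.
  by rewrite truncn_lt_nat // gtr_pMr //; case/andP: (frac01 k).
have {}same_bin : Num.truncn (Q.+1%:R * frac i) = Num.truncn (Q.+1%:R * frac j).
  by have := congr1 (@nat_of_ord _) same_bin; rewrite !inordK.
have /andP[lei lti] := truncn_itv (Qfrac_ge0 i).
have /andP[lej ltj] := truncn_itv (Qfrac_ge0 j).
rewrite same_bin in lei lti.
have -> : (Num.floor (j%:R * s) - Num.floor (i%:R * s))%:~R - (j - i)%:R * s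
    = frac i - frac j.
  by rewrite /frac natrB 1?ltnW // rmorphB /=; ring.
rewrite -(ltr_pM2l QR) divff ?gt_eqF // -{1}(gtr0_norm QR) -normrM.
rewrite -[ltRHS]natr1 in lti; rewrite -[ltRHS]natr1 in ltj.
by rewrite mulrBr ltr_norml; apply/andP; split; lra.
Qed.

Section PellExistence.
Variables (R : realType) (s : R) (D : nat).
Hypotheses (s_gt0 : 0 < s) (s2 : s ^+ 2 = D%:R) (s_irr : irrational s).

Definition pell_norm (z : int * nat) : int := z.1 ^+ 2 - D%:Z * z.2%:Z ^+ 2.
Definition pell_err (z : int * nat) : R := `|z.1%:~R - z.2%:R * s|.

Lemma pell_normE z :
  (pell_norm z)%:~R = (z.1%:~R - z.2%:R * s) * (z.1%:~R + z.2%:R * s) :> R.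
Proof.
by rewrite /pell_norm rmorphB /= rmorphXn /= [in X in _ - X]intrM rmorphXn /= -!pmulrn -s2; ring.
Qed.

Lemma pell_err_gt0 z : (0 < z.2)%N -> 0 < pell_err z.
Proof.
move=> z2; rewrite normr_gt0 subr_eq0; apply/eqP => e; apply: s_irr.
apply/rationalP; exists z.1, z.2.
by rewrite e mulrAC divff ?mul1r // pnatr_eq0 -lt0n.
Qed.

Lemma pell_norm_neq0 z : (0 < z.2)%N -> pell_norm z != 0.
Proof.
move=> z2; rewrite -(intr_eq0 R) pell_normE mulf_neq0 //.
  by rewrite -normr_gt0 (pell_err_gt0 z2).
have := @pell_err_gt0 (- z.1, z.2) z2; rewrite /pell_err normr_gt0 /=.
by rewrite rmorphN -opprD oppr_eq0.
Qed.

(** If [|x - y s| < 1 / Q] with [y <= Q], then [x + y s] is at most about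
    [2 y s], so the norm is bounded independently of [Q]. *)
Lemma small_norm_approx (e : R) : 0 < e -> exists z : int * nat,
  [/\ (0 < z.2)%N, pell_err z < e & `|(pell_norm z)%:~R| <= 1 + 2 * s].
Proof.
move=> e_gt0; pose Q := (Num.truncn e^-1).+1.
have [x [y [y_gt0 y_Q err]]] := @dirichlet_approx R s Q isT.
exists (x, y); split=> //.
  apply: lt_trans err _; rewrite invf_plt ?posrE //.
  exact: truncnS_gt.
rewrite pell_normE normrM /=.
have yR : 0 < y%:R :> R by rewrite ltr0n.
have Q_y : Q%:R^-1 <= y%:R^-1 :> R by rewrite lef_pV2 ?posrE // ler_nat.
have err_y := lt_le_trans err Q_y.
set d := `| _ | in err err_y *.
have d_y : d * y%:R <= 1 by rewrite -ler_pdivlMr // mul1r ltW.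
have d1 : d <= 1.
  by apply: le_trans (ltW err) _; rewrite invf_le1 // ler1n.
have d0 : 0 <= d := normr_ge0 _.
have -> : x%:~R + y%:R * s = (x%:~R - y%:R * s) + 2 * (y%:R * s) by ring.
apply: (@le_trans _ _ (d * (d + 2 * (y%:R * s)))).
  rewrite ler_wpM2l // (le_trans (ler_normD _ _)) // lerD2l ger0_norm //.
  by rewrite !mulr_ge0 // ltW.
have dd : d * d <= 1 by rewrite mulr_ile1.
have sdy : s * (d * y%:R) <= s by rewrite ger_pMr.
by lra.
Qed.

(** The quotient of two elements of [Z[s]] with equal norm [N], congruent
    modulo [N], lies in [Z[s]] and has norm 1: [X] and [Y] are the coordinates
    of [w / z]. *)
Lemma pell_quotient (z w : int * nat) : (0 < z.2)%N -> (0 < w.2)%N ->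
    z != w -> pell_norm z = pell_norm w ->
    (z.1 = w.1 %[mod pell_norm z])%Z ->
    (z.2%:Z = w.2%:Z %[mod pell_norm z])%Z ->
  exists x y : nat, (0 < y)%N /\ (x ^ 2 = D * y ^ 2 + 1)%N.
Proof.
case: z w => [x1 y1] [x2 y2] /= y1_gt0 y2_gt0 neq_zw.
have := @pell_norm_neq0 (x1, y1) y1_gt0; rewrite /pell_norm /=.
set N := x1 ^+ 2 - _ => N0 eqN.
move=> /esym/eqP; rewrite eqz_mod_dvd => /dvdzP[a def_a].
move=> /esym/eqP; rewrite eqz_mod_dvd => /dvdzP[b def_b].
have Ex2 : x2 = x1 + a * N by rewrite -def_a; ring.
have Ey2 : y2%:Z = y1%:Z + b * N by rewrite -def_b; ring.
pose X := 1 + x1 * a - D%:Z * y1%:Z * b; pose Y := x1 * b - y1%:Z * a.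
have NX : N * X = x1 * x2 - D%:Z * y1%:Z * y2%:Z.
  by rewrite Ex2 Ey2 /X /N; ring.
have NY : N * Y = x1 * y2%:Z - x2 * y1%:Z by rewrite Ex2 Ey2 /Y; ring.
have pellXY : X ^+ 2 - D%:Z * Y ^+ 2 = 1.
  have N2 : N ^+ 2 != 0 by rewrite expf_neq0.
  apply: (mulfI N2); rewrite mulr1.
  have -> : N ^+ 2 * (X ^+ 2 - D%:Z * Y ^+ 2)
      = (N * X) ^+ 2 - D%:Z * (N * Y) ^+ 2 by ring.
  rewrite NX NY.
  by rewrite [RHS]expr2 {2}eqN /N; ring.
have Y0 : Y != 0.
  apply: contraNneq neq_zw => Y0.
  have e : x1 * y2%:Z = x2 * y1%:Z.
    by apply/eqP; rewrite -subr_eq0 -NY Y0 mulr0.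
  have yy : y2%:Z ^+ 2 = y1%:Z ^+ 2.
    apply: (mulfI N0); rewrite {2}eqN /N.
    have -> : (x1 ^+ 2 - D%:Z * y1%:Z ^+ 2) * y2%:Z ^+ 2
      = (x1 * y2%:Z) ^+ 2 - D%:Z * y1%:Z ^+ 2 * y2%:Z ^+ 2 by ring.
    by rewrite e; ring.
  have {}yy : y1 = y2.
    by apply/eqP; rewrite -(eqn_exp2r _ _ (isT : (0 < 2)%N)) -!mulnn -eqz_nat !PoszM -!expr2 yy.
  move: e; rewrite yy => /mulIf -> //.
  by rewrite eqz_nat -lt0n.
exists `|X|%N, `|Y|%N; rewrite absz_gt0; split=> //.
apply/eqP; rewrite -!mulnn -eqz_nat PoszD !PoszM !abszE -!expr2 !real_normK ?num_real //.
by rewrite -subr_eq0 -[1%:Z]pellXY; apply/eqP; ring.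
Qed.

(** By [small_norm_approx] there are infinitely many elements of bounded norm.
    Pigeonhole on the norm and the residues modulo the norm yields two to which
    [pell_quotient] applies; the strict decrease of the errors ensures that they
    differ. *)
Lemma pell_exists :
  exists x y : nat, (0 < y)%N /\ (x ^ 2 = D * y ^ 2 + 1)%N.
Proof.
pose good z := (0 < z.2)%N /\ `|(pell_norm z)%:~R| <= 1 + 2 * s.
have /choice[next nextP] z : exists w, good z -> good w /\ pell_err w < pell_err z.
  have [z2|] := boolP (0 < z.2)%N; last by move=> /negP nz2; exists z => -[].
  have [w [w2 w_err w_norm]] := small_norm_approx (pell_err_gt0 z2).
  by exists w.
have [z0 [z02 _ z0_norm]] := small_norm_approx ltr01.
pose u n := iter n next z0.
have u_good n : good (u n) by elim: n => //= n /nextP[].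
have u_err : {homo pell_err \o u : i j / (i < j)%N >-> j < i}.
  apply: homo_ltn => [x y z /[swap]|n /=]; first exact: lt_trans.
  by have [] := nextP _ (u_good n).
pose B := Num.truncn (1 + 2 * s).
have u_norm n : (`|pell_norm (u n)| <= B)%N.
  have [_] := u_good n; rewrite -intr_norm -abszE.
  by rewrite -pmulrn truncn_ge_nat // addr_ge0 // mulr_ge0 // ltW.
(* The norm is shifted by its bound [B] so as to be a natural number. *)
pose cls n : 'I_(B + B).+1 * 'I_B.+1 * 'I_B.+1 := let N := pell_norm (u n) in
  (inord `|N + B%:Z|, inord `|((u n).1 %% N)%Z|, inord `|((u n).2 %% N)%Z|).
pose k := #|{: 'I_(B + B).+1 * 'I_B.+1 * 'I_B.+1}|.
have /injectivePn[i [j neq_ij]] : ~~ injectiveb (fun i : 'I_k.+1 => cls i).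
  by apply/injectiveP => /leq_card; rewrite card_ord ltnn.
have N0 n : pell_norm (u n) != 0 by apply: pell_norm_neq0; case: (u_good n).
have mod_lt n c : (`|(c %% pell_norm (u n))%Z| < B.+1)%N.
  rewrite ltnS; apply: leq_trans (u_norm n).
  by rewrite -lez_nat gez0_abs ?modz_ge0 // abszE ltW ?ltz_mod.
move=> [/(congr1 (@nat_of_ord _)) eN /(congr1 (@nat_of_ord _)) ex
   /(congr1 (@nat_of_ord _)) ey].
have {}eN : pell_norm (u i) = pell_norm (u j).
  have ui := u_norm i; have uj := u_norm j.
  by move: eN; rewrite !inordK; lia.
have abs_mod_inj c d n : `|(c %% pell_norm (u n))%Z|%N = `|(d %% pell_norm (u n))%Z|%N ->
    (c = d %[mod pell_norm (u n)])%Z.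
  by move=> /(congr1 Posz); rewrite !gez0_abs ?modz_ge0.
rewrite !inordK // -eN in ex ey; do 2?exact: mod_lt.
apply: (@pell_quotient (u i) (u j)) => //.
- by case: (u_good i).
- by case: (u_good j).
- apply: contraNneq neq_ij => eq_u; apply/eqP/val_inj => /=.
  case: (ltngtP i j) => // /u_err /=; rewrite eq_u ltxx //.
- exact: abs_mod_inj.
- exact: abs_mod_inj.
Qed.

End PellExistence.

(** * Primes dividing the terms of the Pell sequence *)

Local Notation pZtoC := (map_poly (intr : int -> algC)).

Lemma norm_Cyclotomic_le d (z : algC) : (0 < d)%N ->
  `|(pZtoC 'Phi_d).[z]| <= (1 + `|z|) ^+ totient d.
Proof.
move=> d_gt0; have [w w_prim] := C_prim_root_exists d_gt0.
have norm_w : `|w| = 1.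
  apply/eqP; rewrite -(pexpr_eq1 d_gt0) ?normr_ge0 // -normrX.
  by rewrite (prim_expr_order w_prim) normr1.
rewrite (Cintr_Cyclotomic w_prim) /cyclotomic horner_prod normr_prod.
have -> : totient d = #|[pred k : 'I_d | coprime k d]|.
  rewrite totient_count_coprime big_mkord -sum1_card [RHS]big_mkcond /=.
  by apply: eq_bigr => i _; rewrite inE coprime_sym; case: coprime.
rewrite -prodr_const; apply: ler_prod => k _; rewrite normr_ge0 /= hornerXsubC.
by rewrite (le_trans (ler_normB _ _)) // normrX norm_w expr1n addrC.
Qed.

(** [Z[e]] is spanned by [1] and [e], so [f(e) = u + v e] and [f(e') = u + v e']
    with the same integers [u] and [v]; the product is the norm form. *)
Lemma conjugate_horner_int (S : comNzRingType) (e e' : S) (t n : int)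
    (f : {poly int}) : e + e' = t%:~R -> e * e' = n%:~R ->
  exists N : int, (map_poly intr f).[e] * (map_poly intr f).[e'] = N%:~R.
Proof.
move=> sum_e prod_e.
have [u [v [-> ->]]] : exists u v : int,
    (map_poly intr f).[e] = u%:~R + v%:~R * e /\
    (map_poly intr f).[e'] = u%:~R + v%:~R * e'.
  elim/poly_ind: f => [|f c [u [v [fe fe']]]].
    by exists 0, 0; rewrite rmorph0 !horner0 !mul0r addr0.
  exists (c - v * n), (u + v * t).
  rewrite rmorphD rmorphM /= map_polyX map_polyC /= !hornerE fe fe'.
  rewrite rmorphB rmorphD !rmorphM /= -sum_e -prod_e.
  by split; ring.
exists (u ^+ 2 + u * v * t + v ^+ 2 * n).
rewrite !rmorphD !rmorphM /= -sum_e -prod_e; ring.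
Qed.

Section PellPowers.
Variables x1 y1 D : nat.
Hypothesis pell1 : (x1 ^ 2 = D * y1 ^ 2 + 1)%N.

(** The coordinates of [(x1 + y1 s) ^ n] on [1] and [s], where [s ^ 2 = D]. *)
Definition pell_pow (n : nat) : nat * nat :=
  iter n (fun z => (x1 * z.1 + D * y1 * z.2, y1 * z.1 + x1 * z.2))%N (1, 0)%N.

Lemma pell_powE (S : comNzRingType) (s : S) n : s ^+ 2 = D%:R ->
  (x1%:R + y1%:R * s) ^+ n = (pell_pow n).1%:R + (pell_pow n).2%:R * s.
Proof.
move=> s2; elim: n => [|n IHn]; first by rewrite expr0 mul0r addr0.
by rewrite exprS IHn /= !natrD !natrM -s2; ring.
Qed.

Lemma pell_pow_eq n : ((pell_pow n).1 ^ 2 = D * (pell_pow n).2 ^ 2 + 1)%N.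
Proof.
by elim: n => [|n IHn] /=; [rewrite muln0 | nia].
Qed.

Section Growth.
Hypotheses (D_gt0 : (0 < D)%N) (y1_gt0 : (0 < y1)%N).

Lemma pell_pow_ge n : (2 ^ n <= (pell_pow n.+1).2)%N.
Proof.
have x1_ge2 : (2 <= x1)%N by nia.
elim: n => [|n IHn]; first by rewrite /=; nia.
rewrite [pell_pow _]iterS -/(pell_pow n.+1) /= expnS.
by apply: leq_trans (leq_addl _ _); rewrite leq_mul.
Qed.

Lemma pell_pow_gt0 n : (0 < n)%N -> (0 < (pell_pow n).2)%N.
Proof.
by case: n => // n _; apply: leq_trans (pell_pow_ge n); rewrite expn_gt0.
Qed.

(** The ratio of consecutive terms is bounded, since [x_n <= (D + 1) y_n]. *)
Lemma pell_pow_add_le n k : (0 < n)%N ->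
  ((pell_pow (n + k)).2 <= (x1 + y1 * (D + 1)) ^ k * (pell_pow n).2)%N.
Proof.
move=> n_gt0; elim: k => [|k IHk]; first by rewrite addn0 mul1n.
rewrite addnS expnS -mulnA.
apply: leq_trans (leq_mul (leqnn _) IHk) => /=.
have := pell_pow_gt0 (ltn_addr k n_gt0); have := pell_pow_eq (n + k).
case: (pell_pow _) => x y /= e y_gt0.
have le_xy : (x <= (D + 1) * y)%N by nia.
by rewrite mulnDl addnC leq_add2l -mulnA leq_mul2l le_xy orbT.
Qed.

(** The factorization runs in [algC], where the bound [norm_Cyclotomic_le] is
    available; only its integer consequence is kept. *)
Lemma prime_dvd_pell_pow_le p n : (0 < n)%N -> prime p ->
    (p %| (pell_pow n).2)%N ->
  (p <= (2 * x1 + 2) ^ totient (2 * n))%N.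
Proof.
move=> n_gt0 p_pr p_dvd; set m := (2 * n)%N.
have m_gt0 : (0 < m)%N by rewrite muln_gt0.
pose s : algC := sqrtC D%:R.
have s2 : s ^+ 2 = D%:R by rewrite sqrtCK.
have s_ge0 : 0 <= s by rewrite sqrtC_ge0 ler0n.
pose e := x1%:R + y1%:R * s; pose e' := x1%:R + y1%:R * - s.
have ee' : e * e' = 1.
  have -> : e * e' = x1%:R ^+ 2 - y1%:R ^+ 2 * s ^+ 2 by rewrite /e /e'; ring.
  by rewrite s2 -!natrX pell1 natrD natrM natrX; ring.
have e_gt0 : 0 < e.
  rewrite lt_def; apply/andP; split.
    by apply: contra_eq_neq ee' => ->; rewrite mul0r eq_sym oner_eq0.
  by rewrite addr_ge0 ?mulr_ge0 ?ler0n.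
have e'_gt0 : 0 < e' by rewrite -(pmulr_rgt0 _ e_gt0) ee'.
have /choice[N defN] (d : nat) : exists k : int,
    (pZtoC 'Phi_d).[e] * (pZtoC 'Phi_d).[e'] = k%:~R.
  apply: (@conjugate_horner_int _ _ _ (2 * x1%:Z) 1 'Phi_d _ ee').
  by rewrite /e /e' rmorphM /= -!pmulrn; ring.
have prodN : \prod_(d <- divisors m) N d
    = - (4 * D%:Z * (pell_pow n).2%:Z ^+ 2).
  apply: (@intr_inj algC); rewrite rmorph_prod /=.
  under eq_bigr do rewrite -defN.
  rewrite big_split /= -!horner_prod -!rmorph_prod /= !prod_Cyclotomic //.
  rewrite rmorphB /= map_polyXn rmorph1 !hornerE.
  (* [(a^2 - 1) (b^2 - 1) = - (a - b)^2] when [a b = 1], with [a = e^n]. *)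
  have ab : e ^+ n * e' ^+ n = 1 by rewrite -exprMn ee' expr1n.
  have -> : (e ^+ m - 1) * (e' ^+ m - 1) = - (e ^+ n - e' ^+ n) ^+ 2.
    by rewrite /m mulnC !exprM; ring: ab.
  have s2N : (- s) ^+ 2 = D%:R by rewrite sqrrN.
  rewrite (pell_powE n s2) (pell_powE n s2N).
  by rewrite expr2 rmorphN !rmorphM /= -!pmulrn -s2; ring.
have y_gt0 := pell_pow_gt0 n_gt0.
have prodN0 : \prod_(d <- divisors m) N d != 0.
  have D0 : D%:Z != 0 by lia.
  have y0 : (pell_pow n).2%:Z != 0 by lia.
  by rewrite prodN oppr_eq0 !mulf_neq0 ?expf_neq0.
have : (p %| `|(\prod_(d <- divisors m) N d)%R|)%N.
  by rewrite prodN abszN abszM abszX dvdn_mull // dvdn_exp.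
rewrite (big_morph _ abszM (erefl : `|1%Z|%N = 1%N)) Euclid_dvd_prod // big_has.
case/hasP => d d_m p_Nd; have dm : (d %| m)%N by rewrite dvdn_divisors.
have Nd0 : N d != 0.
  by apply: contraNneq prodN0 => Nd; rewrite prodf_seq_eq0; apply/hasP; exists d; rewrite ?Nd.
apply: leq_trans (dvdn_leq _ p_Nd) _; first by rewrite absz_gt0.
apply: leq_trans (_ : (2 * x1 + 2) ^ totient d <= _)%N; last first.
  by rewrite leq_pexp2l ?addn2 // dvdn_totient_leq.
rewrite -(ler_nat algC) natrX natr_absz intr_norm -defN normrM.
have d_gt0 := dvdn_gt0 m_gt0 dm.
have -> : (2 * x1 + 2)%:R = (1 + `|e|) * (1 + `|e'|) :> algC.
  rewrite !gtr0_norm // natrD natrM.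
  have -> : (1 + e) * (1 + e') = 1 + (e + e') + e * e' by ring.
  by rewrite ee' /e /e'; ring.
by rewrite exprMn ler_pM // norm_Cyclotomic_le.
Qed.
End Growth.
End PellPowers.

(** * Approximations to a quadratic irrational *)

Lemma geometric_bracket (q : nat -> nat) (G N : nat) :
    (forall j, (j <= q j)%N) -> (forall j, (q j.+1 <= G * q j)%N) ->
  (q 0 <= N)%N -> exists j, (q j <= N < G * q j)%N.
Proof.
move=> q_ge q_growth q0_le.
have bounded j : (q j <= N)%N -> (j <= N)%N by apply: leq_trans.
case: (ex_maxnP (ex_intro (fun j => q j <= N)%N _ q0_le) bounded) => j j_le max_j.
exists j; rewrite j_le; apply: leq_trans (q_growth j); rewrite ltnNge.
by apply/negP => /max_j; rewrite ltnn.
Qed.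

Lemma irrational_affine (R : realType) (alpha : R) (m b : int) : m != 0 ->
  irrational alpha -> irrational (m%:~R * alpha + b%:~R).
Proof.
move=> m0 irr [r _ def_r]; apply: irr; exists ((r - b%:~R) / m%:~R) => //.
rewrite fmorph_div rmorphB /= !ratr_int def_r addrK mulrC mulKf //.
by rewrite intr_eq0.
Qed.

(** Complete the square: for a root of [a X^2 + b X + c] the number
    [2 a alpha + b] squares to the discriminant.  Its sign is absorbed by [m]
    and [b]. *)
Lemma quadratic_irrational_sqrt (R : realType) (alpha : R) :
  quadratic_irrational alpha ->
  exists (m b : int) (D : nat) (s : R),
    [/\ m != 0, s = m%:~R * alpha + b%:~R, 0 < s, s ^+ 2 = D%:R & irrational s].
Proof.
case=> irr [p [size_p3 /rootP]]; have size_p : size p = 3%N by [].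

rewrite (@horner_coef_wide _ 3) => [root_p|]; last first.
  by rewrite -size_p size_poly.
have {}root_p : (p`_2)%:~R * alpha ^+ 2 + (p`_1)%:~R * alpha + (p`_0)%:~R = 0 :> R.
  move: root_p; rewrite !big_ord_recl big_ord0 !coef_map /= => <-.
  rewrite expr0 expr1; ring.
have p2 : 2 * p`_2 != 0.
  rewrite mulf_neq0 // -[2%N]/(3.-1) -size_p -lead_coefE lead_coef_eq0.
  by rewrite -size_poly_eq0 size_p.
move: p`_2 p`_1 p`_0 p2 root_p => a b c a2 root_p.
pose s := (2 * a)%:~R * alpha + b%:~R.
pose Delta := b ^+ 2 - 4 * a * c.
have s2 : s ^+ 2 = Delta%:~R.
  have -> : Delta%:~R = b%:~R ^+ 2 - 4 * a%:~R * c%:~R :> R.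
    by rewrite /Delta !expr2 rmorphB /= !rmorphM /= rmorph_nat.
  rewrite /s rmorphM rmorph_nat -[RHS]addr0 -(mulr0 (4 * a%:~R)) -root_p.
  by ring.
have sD : s ^+ 2 = `|Delta|%N%:R.
  by rewrite natr_absz ger0_norm // -(ler0z R) -s2 sqr_ge0.
have s_irr : irrational s by exact: irrational_affine.
have [s_gt0|s_lt0|s0] := ltgtP 0 s.
- by exists (2 * a), b, `|Delta|%N, s.
- have sN : - s = (- (2 * a))%:~R * alpha + (- b)%:~R.
    by rewrite /s !rmorphN; ring.
  exists (- (2 * a)), (- b), `|Delta|%N, (- s).
  rewrite oppr_eq0 oppr_gt0 sqrrN {2}sN; split=> //.
  by apply: irrational_affine; rewrite ?oppr_eq0.
- by case: s_irr; exists 0; rewrite // rmorph0.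
Qed.

(** Compare logarithms in base 2: [log2 p <= t * log2 K <= K * t], using
    [K <= 2 ^ K], while [log2 q >= n]. *)
Lemma smooth_of_totient (R : realType) (eps : R) (K n t q p : nat) : 0 <= eps ->
  K%:R * t%:R <= eps * n%:R -> (2 ^ n <= q)%N -> (p <= K ^ t)%N ->
  p%:R <= q%:R `^ eps.
Proof.
move=> eps_ge0 t_le q_ge p_le.
have two_ge0 : 0 <= 2 :> R by [].
apply: (@le_trans _ _ ((2 ^ n)%N%:R `^ eps)); last first.
  by apply: ge0_ler_powR; rewrite ?nnegrE ?ler0n ?ler_nat.
rewrite natrX -powR_mulrn // -powRrM mulrC.
apply: (@le_trans _ _ (2 `^ (K * t)%N%:R)); last first.
  by rewrite ler_powR ?natrM // ler1n.
rewrite powR_mulrn // -natrX ler_nat expnM (leq_trans p_le) //.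
case: (posnP t) => [->|t_gt0]; first by rewrite !expn0.
by rewrite leq_exp2r; first exact: ltnW (ltn_expl K (isT : (1 < 2)%N)).
Qed.

(** With [q = |m| y], [q alpha] differs from an integer by [s y - x] up to sign,
    and [|s y - x| = 1 / (s y + x) <= 1 / y = |m| / q]. *)
Lemma pell_approx (R : realType) (alpha s : R) (m b : int) (D x y : nat) :
    m != 0 -> s = m%:~R * alpha + b%:~R -> 0 < s -> s ^+ 2 = D%:R ->
    (0 < y)%N -> (x ^ 2 = D * y ^ 2 + 1)%N ->
  exists a : int, `|alpha - a%:~R / (`|m| * y)%N%:R|
    <= `|m|%N%:R / (`|m| * y)%N%:R ^+ 2.
Proof.
move=> m0 def_s s_gt0 s2 y_gt0 pell.
have D_gt0 : (0 < D)%N by rewrite -(ltr0n R) -s2 exprn_gt0.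
have le_yx : (y <= x)%N by nia.
have yR : 0 < y%:R :> R by rewrite ltr0n.
have mR : 0 < `|m|%N%:R :> R by rewrite ltr0n absz_gt0.
have unit_eq : (s * y%:R - x%:R) * (s * y%:R + x%:R) = -1.
  have -> : (s * y%:R - x%:R) * (s * y%:R + x%:R)
    = s ^+ 2 * y%:R ^+ 2 - x%:R ^+ 2 by ring.
  by rewrite s2 -!natrX pell natrD natrM; ring.
have small : `|s * y%:R - x%:R| <= y%:R^-1.
  have sum_ge : y%:R <= s * y%:R + x%:R.
    by rewrite -[leLHS]add0r lerD ?ler_nat // mulr_ge0 // ltW.
  rewrite -(ler_pM2r yR) mulVf ?gt_eqF //.
  rewrite -[leRHS](normrN1 R) -unit_eq normrM ler_wpM2l //.
  exact: le_trans sum_ge (ler_norm _).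
exists (sgz m * (x%:Z - b * y%:Z)).
have m_sg : m%:~R = (sgz m)%:~R * `|m|%N%:R :> R.
  by rewrite natr_absz -rmorphM /= {1}[m]intEsg.
have sg2 : (sgz m)%:~R * (sgz m)%:~R = 1 :> R.
  by rewrite -rmorphM /= mulz_sg m0.
have sg_norm : `|(sgz m)%:~R| = 1 :> R.
  by rewrite -intr_norm normr_sgz m0.
have -> : alpha - (sgz m * (x%:Z - b * y%:Z))%:~R / (`|m| * y)%N%:R
    = (sgz m)%:~R * (s * y%:R - x%:R) / (`|m| * y)%N%:R.
  have qR : (`|m| * y)%N%:R != 0 :> R by rewrite natrM mulf_neq0 ?gt_eqF.
  apply: (mulIf qR); rewrite mulrBl !divfK // natrM def_s m_sg.
  rewrite rmorphM rmorphB rmorphM /= -!pmulrn.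
  by ring: sg2.
rewrite normrM normrM sg_norm mul1r normfV [`|(`|m| * y)%N%:R|]ger0_norm //.
apply: le_trans (ler_wpM2r _ small) _; first by rewrite invr_ge0 ler0n.
rewrite natrM le_eqVlt; apply/orP; left; apply/eqP.
by field; rewrite !gt_eqF.
Qed.

Theorem theorem3 (R : realType) (alpha eps : R)
    (halpha : quadratic_irrational alpha) (heps : 0 < eps) :
  exists C : R, forall N : nat, (0 < N)%N ->
    exists (a : int) (q : nat),
      [/\ (0 < q)%N, (q <= N)%N,
          `|alpha - a%:~R / q%:R| <= C / (q%:R * N%:R) &
          forall p : nat, prime p -> (p %| q)%N -> ~ (q%:R `^ eps < p%:R)].
Proof.
have [m [b [D [s [m0 def_s s_gt0 s2 s_irr]]]]] := quadratic_irrational_sqrt halpha.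
have [x1 [y1 [y1_gt0 pell1]]] := pell_exists s_gt0 s2 s_irr.
have D_gt0 : (0 < D)%N by rewrite -(ltr0n R) -s2 exprn_gt0.
pose Y n := (pell_pow x1 y1 D n).2.
(* The summand [|m|] lets [K] also bound the prime divisors of [m]. *)
pose K := (2 * x1 + 2 + `|m|)%N.
have K_gt0 : 0 < K%:R :> R by rewrite ltr0n; rewrite /K; lia.
have [M M_gt0 totM] : exists2 M : nat, (0 < M)%N & forall n, (0 < n)%N ->
    (M %| n)%N -> (totient n)%:R <= eps / (4 * K%:R) * n%:R :> R.
  by apply: totient_small; rewrite divr_gt0 ?mulr_gt0.
(* The factor 2 ensures [n j >= 2], so that [(n j).-1 >= n j / 2]. *)
pose n j := (2 * M * j.+1)%N.
have n_ge2 j : (2 <= n j)%N by rewrite /n; nia.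
pose q j := (`|m| * Y (n j))%N.
pose G := ((x1 + y1 * (D + 1)) ^ (2 * M))%N.
have m_gt0 : (0 < `|m|)%N by rewrite absz_gt0.
have q_ge j : (2 ^ (n j).-1 <= q j)%N.
  apply: leq_trans (leq_pmull _ m_gt0).
  by have := pell_pow_ge pell1 D_gt0 y1_gt0 (n j).-1; rewrite prednK // ltnW.
have q_gt0 j : (0 < q j)%N by apply: leq_trans (q_ge j); rewrite expn_gt0.
have q_ge_id j : (j <= q j)%N.
  apply: leq_trans (q_ge j); apply: leq_trans (ltnW (ltn_expl _ (isT : (1 < 2)%N))).
  rewrite /n; nia.
have q_growth j : (q j.+1 <= G * q j)%N.
  rewrite /q mulnCA leq_mul2l; apply/orP; right.
  have -> : n j.+1 = (n j + 2 * M)%N by rewrite /n; lia.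
  exact: (pell_pow_add_le pell1 D_gt0 y1_gt0 _ (ltnW (n_ge2 j))).
have smooth j p : prime p -> (p %| q j)%N -> p%:R <= (q j)%:R `^ eps.
  move=> p_pr p_q; set t := totient (2 * n j).
  have t_gt0 : (0 < t)%N by rewrite totient_gt0 muln_gt0 (ltnW (n_ge2 j)).
  apply: (@smooth_of_totient _ _ K (n j).-1 t) => //; first exact: ltW.
    have := totM (2 * n j)%N; rewrite muln_gt0 (ltnW (n_ge2 j)) => /(_ isT).
    rewrite (_ : M %| 2 * n j)%N => [/(_ isT) t_le|]; last first.
      by rewrite dvdn_mull // /n mulnAC dvdn_mull.
    apply: le_trans (ler_wpM2l (ltW K_gt0) t_le) _.
    have -> : K%:R * (eps / (4 * K%:R) * (2 * n j)%:R) = eps * ((n j)%:R / 2).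
      by rewrite natrM; field; rewrite gt_eqF.
    rewrite ler_wpM2l ?(ltW heps) // -subn1 natrB ?(ltnW (n_ge2 j)) //.
    have : 2 <= (n j)%:R :> R by rewrite ler_nat.
    by lra.
  have K_le : (K <= K ^ t)%N by rewrite -[leqLHS]expn1 leq_pexp2l // /K; lia.
  move: p_q; rewrite Euclid_dvdM // => /orP[/(dvdn_leq m_gt0) p_m|p_Y].
    apply: leq_trans K_le; rewrite /K; lia.
  apply: leq_trans (prime_dvd_pell_pow_le pell1 D_gt0 y1_gt0 _ p_pr p_Y) _.
    exact: ltnW.
  by rewrite leq_exp2r // /K leq_addr.
exists (`|m|%N%:R * G%:R + (q 0)%:R) => N N_gt0.
have NR : 0 < N%:R :> R by rewrite ltr0n.
have [N_lt|q0_le] := ltnP N (q 0).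
  exists (Num.floor alpha), 1%N; split=> //; last first.
    by move=> p p_pr; rewrite Euclid_dvd1.
  have /andP[fl_le fl_lt] := floor_itv alpha.
  rewrite divr1 mul1r ler_pdivlMr //.
  apply: (@le_trans _ _ (1 * (q 0)%:R)).
    rewrite ler_pM ?ler0n ?ler_nat ?(ltnW N_lt) // ler_norml.
    by move: fl_lt; rewrite rmorphD /= => fl_lt; apply/andP; split; lra.
  by rewrite mul1r lerDr mulr_ge0 ?ler0n.
have [j /andP[q_le N_lt]] := geometric_bracket q_ge_id q_growth q0_le.
have [a a_approx] := pell_approx m0 def_s s_gt0 s2
  (pell_pow_gt0 pell1 D_gt0 y1_gt0 (ltnW (n_ge2 j))) (pell_pow_eq pell1 (n j)).
exists a, (q j); split=> //; last first.
  by move=> p p_pr p_q; apply/negP; rewrite -leNgt smooth.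
apply: le_trans a_approx _.
have qR : 0 < (q j)%:R :> R by rewrite ltr0n.
rewrite ler_pdivlMr ?mulr_gt0 // -/(Y (n j)) -/(q j).
have -> : `|m|%N%:R / (q j)%:R ^+ 2 * ((q j)%:R * N%:R)
    = `|m|%N%:R * N%:R / (q j)%:R :> R by field; rewrite gt_eqF.
rewrite ler_pdivrMr // mulrDl -mulrA -[leLHS]addr0.
rewrite lerD ?mulr_ge0 ?ler0n // ler_wpM2l ?ler0n //.
by rewrite -natrM ler_nat ltnW.
Qed.
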